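(* Let $(\mathbf{u},\mathbf{h})$ be an axially symmetric smooth solution of the steady MHD equations $$(\mathbf{u}\cdot\nabla)\mathbf{u}+\nabla p=(\mathbf{h}\cdot\nabla)\mathbf{h}+\Delta\mathbf{u},\quad \operatorname{div}\mathbf{u}=0,\quad (\mathbf{u}\cdot\nabla)\mathbf{h}-(\mathbf{h}\cdot\nabla)\mathbf{u}=\Delta\mathbf{h},\quad \operatorname{div}\mathbf{h}=0\quad\text{in }\mathbb{R}^3,$$ with $\lim_{|\mathbf{x}|\to\infty}\mathbf{u}(\mathbf{x})=\lim_{|\mathbf{x}|\to\infty}\mathbf{h}(\mathbf{x})=\mathbf{0}$, of the form $\mathbf{u}=u_r(r,z)\mathbf{e}_r+u_\theta(r,z)\mathbf{e}_\theta+u_z(r,z)\mathbf{e}_z$, $\mathbf{h}=h_\theta(r,z)\mathbf{e}_\theta$. Then $\mathbf{h}\equiv 0$.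
   Context: Cylindrical coordinates: $r=\sqrt{x_1^2+x_2^2}$, $\theta=\arctan(x_2/x_1)$, $z=x_3$, with $\mathbf{e}_r=(\cos\theta,\sin\theta,0)$, $\mathbf{e}_\theta=(-\sin\theta,\cos\theta,0)$, $\mathbf{e}_z=(0,0,1)$. A vector field is axially symmetric if its components in this frame do not depend on $\theta$. The scalar function $p$ is the associated pressure. *)

(* Defs.v *)
From HB Require Import structures.
From mathcomp Require Import all_boot all_order all_algebra.
From mathcomp Require Import all_classical all_reals all_analysis.
Set Implicit Arguments.
Unset Strict Implicit.
Unset Printing Implicit Defensive.
Import Order.TTheory GRing.Theory Num.Theory.
Import numFieldNormedType.Exports.
Local Open Scope classical_set_scope.
Local Open Scope ring_scope.

(* The Cartesian coordinates (x_1, x_2, x_3) of x : 'rV[R]_3 are x 0 i for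
   i = 0, 1, 2 in 'I_3. *)

Definition partial (R : realType) (V : normedModType R) (i : 'I_3)
    (f : 'rV[R]_3 -> V) : 'rV[R]_3 -> V :=
  'D_(delta_mx 0 i) f.

(* C^oo: every iterated partial derivative (of any order, including 0) is
   differentiable everywhere, hence exists and is continuous. *)
Definition smooth (R : realType) (V : normedModType R)
    (f : 'rV[R]_3 -> V) : Prop :=
  forall (s : seq 'I_3) (x : 'rV[R]_3),
    differentiable (foldr (@partial R V) f s) x.

Definition gradient (R : realType) (f : 'rV[R]_3 -> R) (x : 'rV[R]_3)
    : 'rV[R]_3 :=
  \row_i partial i f x.

Definition divergence (R : realType) (u : 'rV[R]_3 -> 'rV[R]_3)
    (x : 'rV[R]_3) : R :=
  \sum_i partial i (fun y => u y 0 i) x.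

Definition laplacian (R : realType) (u : 'rV[R]_3 -> 'rV[R]_3)
    (x : 'rV[R]_3) : 'rV[R]_3 :=
  \sum_i partial i (partial i u) x.

(* (u . nabla) v *)
Definition advection (R : realType) (u v : 'rV[R]_3 -> 'rV[R]_3)
    (x : 'rV[R]_3) : 'rV[R]_3 :=
  \sum_i u x 0 i *: partial i v x.

Definition steady_MHD (R : realType) (u h : 'rV[R]_3 -> 'rV[R]_3)
    (p : 'rV[R]_3 -> R) : Prop :=
  forall x : 'rV[R]_3,
    [/\ advection u u x + gradient p x = advection h h x + laplacian u x,
        divergence u x = 0,
        advection u h x - advection h u x = laplacian h x
      & divergence h x = 0].

(* The filter |x| -> oo. The norm of 'rV[R]_3 is the sup norm; by equivalence
   of norms, the Euclidean norm defines the same filter. *)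
Definition at_infinity (R : realType) : set_system 'rV[R]_3 :=
  filter_from setT (fun M : R => [set x : 'rV[R]_3 | M < `|x|]).
Arguments at_infinity R : clear implicits.

Definition e_r (R : realType) (theta : R) : 'rV[R]_3 :=
  \row_i [:: cos theta; sin theta; 0]`_i.

Definition e_theta (R : realType) (theta : R) : 'rV[R]_3 :=
  \row_i [:: - sin theta; cos theta; 0]`_i.

Definition e_z (R : realType) : 'rV[R]_3 := \row_i [:: 0; 0; 1]`_i.

Definition cylindrical (R : realType) (r theta z : R) : 'rV[R]_3 :=
  \row_i [:: r * cos theta; r * sin theta; z]`_i.

(* v = v_r(r, z) e_r + v_theta(r, z) e_theta + v_z(r, z) e_z. This is required
   off the axis r = 0 only, where theta and the frame are defined. *)
Definition axisymmetric_form (R : realType) (v : 'rV[R]_3 -> 'rV[R]_3)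
    (v_r v_theta v_z : R -> R -> R) : Prop :=
  forall r theta z : R, 0 < r ->
    v (cylindrical r theta z) =
      v_r r z *: e_r theta + v_theta r z *: e_theta theta + v_z r z *: e_z R.

(* v = v_theta(r, z) e_theta *)
Definition swirl_form (R : realType) (v : 'rV[R]_3 -> 'rV[R]_3)
    (v_theta : R -> R -> R) : Prop :=
  forall r theta z : R, 0 < r ->
    v (cylindrical r theta z) = v_theta r z *: e_theta theta.

(* Main.v *)
Require Import Defs.
From HB Require Import structures.
From mathcomp Require Import all_boot all_order all_algebra.
From mathcomp Require Import all_classical all_reals all_analysis.
From mathcomp Require Import ring lra.
Set Implicit Arguments.
Unset Strict Implicit.
Unset Printing Implicit Defensive.
Import Order.TTheory GRing.Theory Num.Theory.
Import numFieldNormedType.Exports.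
Local Open Scope classical_set_scope.
Local Open Scope ring_scope.

(* Off the axis write h = H e_theta in the half-plane x_2 = 0.  The e_theta
   component of the induction equation says that Pi = H / r satisfies
   Pi_rr + (3 / r) Pi_r + Pi_zz = u_r Pi_r + u_z Pi_z, so Pi obeys a maximum
   principle.  As Pi is not known to decay at infinity near the axis, one
   compares it with the strict supersolution
   B - eta exp (M^2 r^2) + eps / r, where |u_r| <= M and eps M <= eta: only
   where H >= eps can Pi exceed it for suitable B, and this set is compact in
   0 <= r <= R1 and avoids the axis.  Letting eps -> 0, eta -> 0 and
   R1 -> oo gives H <= 0; applied to -H this gives H = 0. *)

(** * Second-derivative test and one-variable derivatives *)

(** The first-order part is Fermat's rule. If [l] were positive, the difference quotients of [df] at
    [c] would be positive, so [df > 0] just to the right of [c]; the mean value theorem on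
    [[c, c + m]] then gives [f (c + m) > f c]. *)
Lemma local_max_derive_test (R : realType) (f df : R -> R) (c l : R) :
    (\forall t \near c, is_derive (t : R) 1 f (df t)) ->
    is_derive c 1 df l ->
    (\forall t \near c, f t <= f c) ->
  df c = 0 /\ l <= 0.
Proof.
move=> f_df df_l f_max.
have /nbhs_ballP[e /= e0 He] : nbhs c
  [set t : R | is_derive t 1 f (df t) /\ f t <= f c] by exact: filterI.
have inb (t : R) : `|t - c| < e -> is_derive t 1 f (df t) /\ f t <= f c.
  by move=> tc; apply: He; rewrite -ball_normE /= distrC.
have fc (t : R) : `|t - c| < e -> {for t, continuous f}.
  by move=> /inb[d _]; apply/differentiable_continuous/derivable1_diffP.
have [d0 _] : is_derive c 1 f (df c) /\ f c <= f c.
  by apply: inb; rewrite subrr normr0.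
have dfc0 : df c = 0.
  have d1 : is_derive c 1 f 0.
    apply: (@derive1_at_max R f (c - e) (c + e) c); [lra| | |].
    - move=> t; rewrite in_itv /= => tce.
      by have [] : is_derive t 1 f (df t) /\ f t <= f c
        by apply: inb; rewrite ltr_norml; lra.
    - by rewrite in_itv /=; apply/andP; split; lra.
    - move=> t; rewrite in_itv /= => tce.
      by have [] : is_derive t 1 f (df t) /\ f t <= f c
        by apply: inb; rewrite ltr_norml; lra.
  by rewrite -(@derive_val _ _ _ _ _ _ _ d0) (@derive_val _ _ _ _ _ _ _ d1).
split=> //; rewrite leNgt; apply/negP => l0.
have cvl : h^-1 * df (h + c) @[h --> (0 : R)^'] --> l.
  case: df_l => dd <-.
  have hy' : (fun h : R => h^-1 *: (df (h *: 1 + c) - df c)) =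
     (fun h => h^-1 * df (h + c)).
    by apply/funext => h; rewrite dfc0 subr0 /GRing.scale /= mulr1.
  by move: dd; rewrite /derivable /derive /= hy'.
have [d /= dp Hd] : \forall h \near (0 : R)^', 0 < h^-1 * df (h + c).
  exact: (cvgr_gt _ cvl).
pose m := Num.min d e / 2.
have m0 : 0 < m by rewrite divr_gt0// lt_min dp e0.
have [md me] : m < d /\ m < e.
  have h1 : Num.min d e <= d by rewrite ge_min lexx.
  have h2 : Num.min d e <= e by rewrite ge_min lexx orbT.
  by rewrite /m; lra.
have ccm : c < c + m by lra.
have [||s] := @MVT R f df _ _ ccm.
- move=> x; rewrite in_itv /= => hx.
  by have [] : is_derive x 1 f (df x) /\ f x <= f c
    by apply: inb; rewrite ltr_norml; lra.
- apply: continuous_in_subspaceT => x; rewrite inE /= in_itv /= => hx.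
  by apply: fc; rewrite ltr_norml; lra.
rewrite in_itv /= => /andP[cs sm] hs.
have [_ fm] : is_derive (c + m) 1 f (df (c + m)) /\ f (c + m) <= f c.
  by apply: inb; rewrite ltr_norml; lra.
have : 0 < (s - c)^-1 * df (s - c + c).
  apply: Hd; first by rewrite /= sub0r normrN ltr_norml; lra.
  by rewrite subr_eq0 gt_eqF.
rewrite subrK pmulr_rgt0 ?invr_gt0; last by lra.
move=> dfs; suff : 0 < df s * (c + m - c) by lra.
by apply: mulr_gt0 => //; lra.
Qed.

Lemma is_derive_add (R : realType) (f g : R -> R) (x a b : R) :
  is_derive x 1 f a -> is_derive x 1 g b ->
  is_derive x 1 (fun t : R => f t + g t) (a + b).
Proof. by move=> *; exact: is_deriveD. Qed.

Lemma is_derive_mul (R : realType) (f g : R -> R) (x a b : R) :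
  is_derive x 1 f a -> is_derive x 1 g b ->
  is_derive x 1 (fun t : R => f t * g t) (f x * b + g x * a).
Proof. by move=> *; exact: is_deriveM. Qed.

Lemma is_derive_scale (R : realType) (k : R) (f : R -> R) (x a : R) :
  is_derive x 1 f a -> is_derive x 1 (fun t : R => k * f t) (k * a).
Proof. by move=> *; exact: (@is_deriveZ _ _ _ f k). Qed.

Lemma is_derive_shift_var (R : realType) (c x : R) :
  is_derive x 1 (fun t : R => c + t) (1 : R).
Proof.
by have := is_derive_add (is_derive_cst c x (1 : R)) (is_derive_id x 1);
  rewrite add0r.
Qed.

Lemma is_derive_sqr_shift (R : realType) (c x : R) :
  is_derive x 1 (fun t : R => (c + t) ^+ 2) (2 * (c + x)).
Proof.
have h := is_derive_shift_var c x.
by apply: is_derive_eq (is_derive_mul h h) _; ring.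
Qed.

Lemma is_derive_gauss (R : realType) (l c x : R) :
  is_derive x 1 (fun t : R => expR (l * (c + t) ^+ 2))
    (2 * l * (c + x) * expR (l * (c + x) ^+ 2)).
Proof.
have h := @is_derive1_comp _ expR (fun t : R => l * (c + t) ^+ 2) x _ _
  (is_derive_expR _) (is_derive_scale l (is_derive_sqr_shift c x)).
by apply: is_derive_eq h _; ring.
Qed.

Lemma is_derive_inv_norm (R : realType) (r x : R) : 0 < r ->
  is_derive x 1 (fun s : R => (Num.sqrt (r ^+ 2 + s ^+ 2))^-1)
    (- (x * (Num.sqrt (r ^+ 2 + x ^+ 2))^-1 ^+ 3)).
Proof.
move=> r0; have q0 : 0 < r ^+ 2 + x ^+ 2.
  by rewrite ltr_wpDr ?sqr_ge0 ?exprn_gt0.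
have s0 : Num.sqrt (r ^+ 2 + x ^+ 2) != 0 by rewrite gt_eqF ?sqrtr_gt0.
have dq : is_derive x 1 (fun s : R => r ^+ 2 + s ^+ 2) (2 * x).
  have := is_derive_add (is_derive_cst (r ^+ 2) x (1 : R))
    (is_derive_sqr_shift 0 x).
  by under eq_fun do rewrite add0r; rewrite !add0r.
have := @is_deriveV _ _ x _ 1 s0
  (@is_derive1_comp _ Num.sqrt (fun s : R => r ^+ 2 + s ^+ 2) _ _ _
    (is_derive1_sqrt q0) dq).
by move/is_derive_eq; apply; rewrite /= /GRing.scale /=; field.
Qed.

(** * Points and coordinate lines in Cartesian coordinates *)

(** Shaped like [cylindrical], so that [cylindrical r theta z] is by definition
    [point3 (r * cos theta) (r * sin theta) z]. *)
Definition point3 (R : realType) (a b c : R) : 'rV[R]_3 :=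
  \row_i [:: a; b; c]`_i.

Lemma point3_eta (R : realType) (x : 'rV[R]_3) :
  x = point3 (x 0 0) (x 0 1) (x 0 2).
Proof.
apply/rowP => i; rewrite mxE.
by case: i => [[|[|[|//]]]] h; congr (x _ _); exact: val_inj.
Qed.

Lemma point3_line (R : realType) (a b c t : R) :
  [/\ t *: delta_mx 0 (0 : 'I_3) + point3 a b c = point3 (a + t) b c,
      t *: delta_mx 0 (1 : 'I_3) + point3 a b c = point3 a (b + t) c
    & t *: delta_mx 0 (2 : 'I_3) + point3 a b c = point3 a b (c + t)].
Proof.
by split; apply/rowP => -[[|[|[|//]]]] ? /=;
  rewrite !mxE /= ?mulr1 ?mulr0 ?add0r 1?addrC.
Qed.

Lemma sum_ord3 (V : nmodType) (F : 'I_3 -> V) : \sum_i F i = F 0 + F 1 + F 2.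
Proof.
rewrite !big_ord_recl big_ord0 addr0 addrA.
by congr (F _ + F _ + F _); exact: val_inj.
Qed.

Lemma is_derive_line (R : realType) (V W : normedModType R) (f : V -> W)
    (x v : V) (t : R) (df : W) :
  is_derive (t *: v + x) v f df ->
  is_derive t 1 (fun s : R => f (s *: v + x)) df.
Proof.
have e : (fun h : R => h^-1 *: (f (h *: v + (t *: v + x)) - f (t *: v + x)))
  = (fun h : R => h^-1 *: (f ((h *: 1 + t) *: v + x) - f (t *: v + x))).
  by apply/funext => h; rewrite /GRing.scale /= mulr1 addrA -scalerDl.
by case=> d dfE; constructor; [move: d|move: dfE];
  rewrite /derivable /derive /= e.
Qed.

Lemma continuous_line (R : realType) (V : normedModType R) (v x : V) :
  continuous (fun t : R => t *: v + x).
Proof.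
move=> t; apply: (@continuousD _ _ _ (fun t : R => t *: v) (fun=> x)).
  exact: scalel_continuous.
exact: cst_continuous.
Qed.

(** * Touching from above by the barrier *)

(** The difference [f - T] has a local maximum at 0, so the second-derivative test applies to it. *)
Lemma touching_derive_test (R : realType) (f df T dT : R -> R) (l m : R) :
    (forall t : R, is_derive t 1 f (df t)) -> is_derive (0 : R) 1 df l ->
    (forall t : R, is_derive t 1 T (dT t)) -> is_derive (0 : R) 1 dT m ->
    (\forall t \near (0 : R), f t <= T t) -> f 0 = T 0 ->
  df 0 = dT 0 /\ l <= m.
Proof.
move=> f1 f2 T1 T2 fT fT0.
have subE (g g' : R -> R) (x a b : R) : is_derive x 1 g a ->
    is_derive x 1 g' b -> is_derive x 1 (fun t => g t - g' t) (a - b).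
  by move=> *; exact: is_deriveB.
have [] := @local_max_derive_test R (fun t => f t - T t)
  (fun t => df t - dT t) 0 (l - m).
- by apply: (@nearW _ (nbhs (0 : R))) => t; exact: subE.
- by apply: filterS fT => t; rewrite fT0 subrr subr_le0.
by move=> e0 lm; split; lra.
Qed.

(* First-order touching at [P] turns the equation into a relation between
   [v0] and the second derivatives, which touching bounds from above by those
   of the barrier, a strict supersolution. *)
Lemma barrier_not_touched (R : realType) (H : 'rV[R]_3 -> R)
    (D D2 : 'I_3 -> 'rV[R]_3 -> R) (v0 v1 v2 r0 z0 R1 B eta eps M : R) :
    (forall i x, is_derive x (delta_mx 0 i) H (D i x)) ->
    (forall i x, is_derive x (delta_mx 0 i) (D i) (D2 i x)) ->
    (forall a b z, 0 < a ^+ 2 + b ^+ 2 -> H (point3 a b z) =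
      H (point3 (Num.sqrt (a ^+ 2 + b ^+ 2)) 0 z)
        * (a * (Num.sqrt (a ^+ 2 + b ^+ 2))^-1)) ->
    0 < r0 -> r0 < R1 -> 0 < eta -> 0 < eps -> 0 < M -> eps * M <= eta ->
    `|v0| <= M ->
    (forall r z, 0 < r -> r <= R1 -> H (point3 r 0 z) <=
      r * (B - eta * expR (M ^+ 2 * r ^+ 2)) + eps) ->
    let P := point3 r0 0 z0 in
    H P = r0 * (B - eta * expR (M ^+ 2 * r0 ^+ 2)) + eps ->
    v0 * D 0 P + v1 * D 1 P + v2 * D 2 P - H P * (v0 / r0) =
      D2 0 P + D2 1 P + D2 2 P ->
  False.
Proof.
move=> dH dD Hsym r0p r0R eta0 eps0 M0 epsM v0M Hle P HP eqn.
have [l0 l1 l2] : [/\ forall t, t *: delta_mx 0 0 + P = point3 (r0 + t) 0 z0,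
    forall t, t *: delta_mx 0 1 + P = point3 r0 t z0
  & forall t, t *: delta_mx 0 2 + P = point3 r0 0 (z0 + t)].
  by split=> t; have [h0 h1 h2] := point3_line r0 0 z0 t;
    rewrite ?h0 ?h1 ?h2 ?add0r.
have line i (t : R) := is_derive_line (dH i (t *: delta_mx 0 i + P)).
have line2 i := is_derive_line (dD i (0 *: delta_mx 0 i + P)).
have P0 i : 0 *: delta_mx 0 i + P = P by rewrite scale0r add0r.
set L := M ^+ 2 in Hle HP *.
set E := expR (L * r0 ^+ 2) in HP *.
have E0 : 0 < E by exact: expR_gt0.
have L0 : 0 < L by rewrite exprn_gt0.
(* Along x_1 the line stays in the half-plane, so [T] is the barrier for [H] at radius [r0 + t]; [m]
   is its second derivative at 0. *)
have [] := touching_derive_test (line 0) (line2 0)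
  (T := fun t => (r0 + t) * (B + - eta * expR (L * (r0 + t) ^+ 2)) + eps)
  (dT := fun t => B + - eta * expR (L * (r0 + t) ^+ 2) +
    (r0 + t) * (- eta * (2 * L * (r0 + t) * expR (L * (r0 + t) ^+ 2))))
  (m := - eta * E * L * r0 * (6 + 4 * L * r0 ^+ 2)).
- move=> t; apply: is_derive_eq (is_derive_add
    (is_derive_mul (is_derive_shift_var r0 t) (is_derive_add
    (is_derive_cst B t (1 : R))
    (is_derive_scale (- eta) (is_derive_gauss L r0 t))))
    (is_derive_cst eps t (1 : R))) _.
  rewrite /=; ring.
- apply: is_derive_eq (is_derive_add (is_derive_add
    (is_derive_cst B 0 (1 : R))
    (is_derive_scale (- eta) (is_derive_gauss L r0 0)))
    (is_derive_mul (is_derive_shift_var r0 0)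
      (is_derive_scale (- eta) (is_derive_mul
        (is_derive_scale (2 * L) (is_derive_shift_var r0 0))
        (is_derive_gauss L r0 0))))) _.
  rewrite /= addr0 -/E; ring.
- near=> t; rewrite l0; have := Hle (r0 + t) z0; rewrite mulNr.
  have : `|t| < Num.min r0 (R1 - r0).
    near: t; apply: (@pseudometric_normed_Zmodule.nbhs0_lt R R^o).
    by rewrite lt_min r0p subr_gt0.
  rewrite lt_min !ltr_norml => /andP[/andP[t1 t2] /andP[t3 t4]].
  by apply; lra.
- by rewrite P0 addr0 HP mulNr.
rewrite P0 !addr0 => D0E D20.
(* Along x_2 the radius is rho = sqrt (r0^2 + t^2), and [Hsym] multiplies the barrier at rho by r0 /
   rho. Since exp (L rho^2) = E exp (L t^2), the product is the [T] below. *)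
have [] := touching_derive_test (line 1) (line2 1)
  (T := fun t => r0 * (B + (- eta * E * expR (L * (0 + t) ^+ 2) +
    eps * (Num.sqrt (r0 ^+ 2 + t ^+ 2))^-1)))
  (dT := fun t => r0 * (- eta * E * (2 * L * (0 + t) *
    expR (L * (0 + t) ^+ 2)) +
    eps * (- (t * (Num.sqrt (r0 ^+ 2 + t ^+ 2))^-1 ^+ 3))))
  (m := r0 * (- eta * E * (2 * L) - eps * r0^-1 ^+ 3)).
- move=> t; apply: is_derive_eq (is_derive_scale r0 (is_derive_add
    (is_derive_cst B t (1 : R)) (is_derive_add
      (is_derive_scale (- eta * E) (is_derive_gauss L 0 t))
      (is_derive_scale eps (is_derive_inv_norm t r0p))))) _.
  by rewrite add0r.
(* [g3] differentiates rho^-3 at 0; in the derivative of t rho^-3 it is multiplied by t = 0, leaving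
   r0^-3. *)
- have g3 := is_derive_mul (is_derive_inv_norm 0 r0p) (is_derive_mul
    (is_derive_inv_norm 0 r0p) (is_derive_inv_norm 0 r0p)).
  have := is_derive_scale r0 (is_derive_add
    (is_derive_scale (- eta * E) (is_derive_mul
      (is_derive_scale (2 * L) (is_derive_shift_var 0 0))
      (is_derive_gauss L 0 0)))
    (is_derive_scale (- eps) (is_derive_mul (is_derive_id 0 (1 : R)) g3))).
  rewrite (_ : (fun t => _) = (fun t => r0 * (- eta * E * (2 * L * (0 + t) *
    expR (L * (0 + t) ^+ 2)) +
    eps * - (t * (Num.sqrt (r0 ^+ 2 + t ^+ 2))^-1 ^+ 3)))); last first.
    by apply/funext => t /=; ring.
  move/is_derive_eq; apply.
  rewrite /= !addr0 expr0n /= !addr0 !mulr0 !expR0 sqrtr_sqr gtr0_norm //; ring.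
- near=> t; rewrite l1.
  have rho0 : 0 < r0 ^+ 2 + t ^+ 2 by rewrite ltr_wpDr ?sqr_ge0 ?exprn_gt0.
  rewrite Hsym //; set rho := Num.sqrt _.
  have rho1 : 0 < rho by rewrite sqrtr_gt0.
  have rho2 : rho ^+ 2 = r0 ^+ 2 + t ^+ 2 by rewrite sqr_sqrtr // ltW.
  have : H (point3 rho 0 z0) <= rho * (B - eta * expR (L * rho ^+ 2)) + eps.
    apply: Hle => //; have rt : `|t| < R1 - r0.
      near: t; apply: (@pseudometric_normed_Zmodule.nbhs0_lt R R^o).
      by rewrite subr_gt0.
    apply: (@le_trans _ _ (r0 + `|t|)); last by lra.
    rewrite -ler_sqr ?nnegrE ?(ltW rho1) ?addr_ge0 ?(ltW r0p) // rho2 sqrrD.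
    rewrite real_normK ?num_real // lerD2r lerDl mulrn_wge0 // mulr_ge0 //.
    exact: ltW.
  rewrite rho2 (mulrDr L) expRD add0r -/E => Hrho.
  apply: (@le_trans _ _
      ((rho * (B - eta * (E * expR (L * t ^+ 2))) + eps) * (r0 / rho))).
    by rewrite ler_pM2r // divr_gt0.
  rewrite le_eqVlt; apply/orP; left; apply/eqP; field; exact: lt0r_neq0.
- rewrite P0 HP addr0 expr0n /= addr0 mulr0 expR0 sqrtr_sqr gtr0_norm //.
  by field; exact: lt0r_neq0.
rewrite P0 !addr0 => D1E D21.
(* The barrier does not depend on z, so it is constant along x_3. *)
have [] := touching_derive_test (line 2) (line2 2)
  (T := fun=> H P) (dT := fun=> 0) (m := 0).
- apply: (@nearW _ (nbhs (0 : R))) => t; rewrite l2 HP; apply: Hle => //.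
  exact: ltW.
- by rewrite P0.
rewrite P0 => D2E D22.
have D1_0 : D 1 P = 0.
  by rewrite D1E !(mulr0, mul0r, oppr0, addr0).
move: eqn; rewrite D0E D1_0 D2E HP => eqn.
(* [E >= 1] turns the smallness condition on [eps] into [eps * M <= k]. *)
have E1 : 1 <= E by rewrite -expR0 ler_expR mulr_ge0 ?sqr_ge0 // ltW.
set k := eta * E.
have kM : eps * M <= k by rewrite (le_trans epsM) // ler_peMr // ltW.
have v0le : v0 <= M by move: v0M; rewrite ler_norml => /andP[].
have x0 := lt0r_neq0 r0p.
(* The drift and zeroth-order terms combine to v0 (D0 - H / r0), which is v0 r0 times the radial
   derivative of H / r; the constant [B] cancels. *)
have sum2 : D2 0 P + D2 1 P + D2 2 P =
    - (v0 * (2 * k * L * r0 ^+ 2 + eps / r0)).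
  by rewrite -eqn -/E /k; field.
have sum2_le : D2 0 P + D2 1 P + D2 2 P <=
    - (k * L * r0 * (8 + 4 * L * r0 ^+ 2) + eps / r0 ^+ 2).
  apply: (le_trans (lerD (lerD D20 D21) D22)).
  by rewrite le_eqVlt; apply/orP; left; apply/eqP; rewrite /k; field.
have drift : v0 * (2 * k * L * r0 ^+ 2 + eps / r0) <=
    M * (2 * k * L * r0 ^+ 2 + eps / r0).
  have k0 : 0 < k by exact: mulr_gt0.
  by rewrite ler_wpM2r // addr_ge0 // ?divr_ge0 ?mulr_ge0 ?exprn_ge0 // ltW.
have main : k * L * r0 * (8 + 4 * L * r0 ^+ 2) + eps / r0 ^+ 2 <=
    M * (2 * k * L * r0 ^+ 2 + eps / r0) by lra.
(* Impossible: with [y = M r0], [k r0 >= eps y] makes the left-hand side at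
   least [7 eps y^3], which exceeds [eps (y - 1)]. *)
have {}main : k * r0 * (M * r0) ^+ 2 * (8 + 4 * (M * r0) ^+ 2 - 2 * (M * r0))
    <= eps * (M * r0 - 1).
  have q0 : 0 < r0 ^+ 2 by rewrite exprn_gt0.
  move: main; rewrite -(ler_pM2r q0) /L => main.
  rewrite -subr_ge0; move: main; rewrite -subr_ge0; congr (0 <= _).
  by field.
have kr : eps * (M * r0) <= k * r0 by rewrite mulrA ler_pM2r.
have y0 : 0 < M * r0 by exact: mulr_gt0.
move: (M * r0) (k * r0) y0 kr main => y w y0 yw main.
have h7 : 7 <= 8 + 4 * y ^+ 2 - 2 * y by nra.
have h1 : eps * y * y ^+ 2 * 7 <=
    w * y ^+ 2 * (8 + 4 * y ^+ 2 - 2 * y).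
  apply: ler_pM => //.
  - by rewrite !mulr_ge0 ?sqr_ge0 // ltW.
  - by rewrite ler_wpM2r ?sqr_ge0.
have : eps * (y * y ^+ 2 * 7) <= eps * (y - 1) by lra.
rewrite ler_pM2l // => h2.
have : 0 < y * (7 * y ^+ 2 - 1) + 1 by nra.
lra.
Unshelve. all: by end_near.
Qed.

(** * The maximum principle for the swirl *)

Lemma continuous_barrier (R : realType) (T : topologicalType) (f g : T -> R)
    (a b c : R) (x : T) :
  {for x, continuous f} -> {for x, continuous g} -> g x != 0 ->
  {for x, continuous (fun y => (f y - a) * (g y)^-1 + b * expR (c * g y ^+ 2))}.
Proof.
move=> cf cg g0; rewrite /prop_for /continuous_at; apply: cvgD.
  by apply: cvgM; [apply: cvgB => //; exact: cvg_cst | exact: cvgV].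
apply: cvgMl_tmp; apply: continuous_cvg; first exact: continuous_expR.
by apply: cvgMl_tmp; under eq_fun do rewrite expr2; exact: cvgM.
Qed.

Lemma ler_norm_coord (R : realType) (n : nat) (x : 'rV[R]_n) (i : 'I_n) :
  `|x 0 i| <= `|x|.
Proof.
rewrite [leRHS]mx_normrE.
exact: (le_bigmax _ (fun ij : 'I_1 * 'I_n => `|x ij.1 ij.2|) (0, i)).
Qed.

(** If the bound failed somewhere, [F] would exceed [B0] there. At a maximum point [P] of [F] on the
    compact set [A], the barrier with constant [F P] would then touch [H] from above, which
    [barrier_not_touched] excludes. *)
Lemma swirl_barrier_bound (R : realType) (H v0 v1 v2 : 'rV[R]_3 -> R)
    (D D2 : 'I_3 -> 'rV[R]_3 -> R) (C M : R) :
    (forall i x, is_derive x (delta_mx 0 i) H (D i x)) ->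
    (forall i x, is_derive x (delta_mx 0 i) (D i) (D2 i x)) ->
    continuous H ->
    (forall a b z, 0 < a ^+ 2 + b ^+ 2 -> H (point3 a b z) =
      H (point3 (Num.sqrt (a ^+ 2 + b ^+ 2)) 0 z)
        * (a * (Num.sqrt (a ^+ 2 + b ^+ 2))^-1)) ->
    (forall z, H (point3 0 0 z) = 0) ->
    (forall e, 0 < e -> exists N, forall x, N < `|x| -> H x <= e) ->
    (forall x, H x <= C) -> 0 < C -> 0 < M -> (forall x, `|v0 x| <= M) ->
    (forall r z, 0 < r -> let P := point3 r 0 z in
      v0 P * D 0 P + v1 P * D 1 P + v2 P * D 2 P - H P * (v0 P / r) =
      D2 0 P + D2 1 P + D2 2 P) ->
  forall R1 eta eps, 0 < R1 -> 0 < eta -> 0 < eps -> eps * M <= eta ->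
  forall r z, 0 < r -> r <= R1 -> H (point3 r 0 z) <=
    r * (C / R1 + eta * expR (M ^+ 2 * R1 ^+ 2) -
      eta * expR (M ^+ 2 * r ^+ 2)) + eps.
Proof.
move=> dH dD cH Hsym axis decay HC C0 M0 v0M eqn R1 eta eps R10 eta0 eps0 epsM.
move=> r z r0 rR1; rewrite leNgt; apply/negP => Hrz.
(* [B0] serves twice: it dominates eta exp (M^2 s^2) for 0 < s <= R1, so the barrier is at least
   [eps] there, and its term C / R1 forces F <= B0 on r = R1. *)
set B0 := C / R1 + _ in Hrz.
have expm s : 0 < s -> s <= R1 -> eta * expR (M ^+ 2 * s ^+ 2) <= B0.
  move=> s0 sR.
  rewrite /B0 -[leLHS]add0r lerD ?divr_ge0 ?(ltW C0) ?(ltW R10) //.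
  by rewrite ler_pM2l // ler_expR ler_wpM2l ?sqr_ge0 // ler_sqr // nnegrE ltW.
have [N HN] := decay _ eps0.
(* [F x] is the constant for which the barrier takes the value [H x] at [x]. *)
pose F (x : 'rV[R]_3) :=
  (H x - eps) * (x 0 0)^-1 + eta * expR (M ^+ 2 * x 0 0 ^+ 2).
(* The factor {0} restricts the box to the half-plane x_2 = 0; its other sides are 0 <= r <= R1 and
   |z| <= |N|. *)
pose I3 (i : 'I_3) : set R :=
  nth set0 [:: `[0, R1]%classic; [set 0 : R]; `[- `|N|, `|N|]%classic] i.
pose A := [set x : 'rV[R]_3 | forall i, I3 i (x ord0 i)] `&`
  H @^-1` [set t | eps <= t].
have AE a c : A (point3 a 0 c) <->
    [/\ 0 <= a, a <= R1, `|c| <= `|N| & eps <= H (point3 a 0 c)].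
  split.
    move=> [h ?]; have := h 0; have := h 2; rewrite /I3 /= !mxE /= !in_itv /=.
    by rewrite ler_norml => -> /andP[-> ->].
  move=> [a0 aR cN hA]; split => // i; rewrite mxE.
  case: i => [[|[|[|//]]]] hi; rewrite /I3 /= ?in_itv /= ?a0 ?aR -?ler_norml //.
have A2 x : A x -> x = point3 (x 0 0) 0 (x 0 2).
  by move=> [h _]; rewrite [LHS]point3_eta; congr (point3 _ _ _); exact: (h 1).
have cA : compact A.
  apply: compact_closedI.
    apply: rV_compact => -[[|[|[|//]]]] hi /=; rewrite /I3 /=.
    - exact: segment_compact.
    - exact: compact_set1.
    - exact: segment_compact.
  by apply: preimage_closed; [move=> ? _; exact: cH | exact: closed_ge].
have Hbig a c : `|N| < `|c| -> H (point3 a 0 c) <= eps.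
  move=> Nc; apply: HN; rewrite (le_lt_trans (ler_norm N)) //.
  rewrite (lt_le_trans Nc) //.
  by have := ler_norm_coord (point3 a 0 c) 2; rewrite mxE.
(* [H] vanishes on the axis but is at least [eps] on [A]; hence [F] is continuous on [A]. *)
have Apos x : A x -> 0 < x 0 0.
  move=> Ax; have := Ax; rewrite (A2 _ Ax) => /AE [a0 _ _ he].
  rewrite mxE /= lt_neqAle a0 andbT; apply/eqP => e0.
  by move: he; rewrite -e0 axis leNgt eps0.
have Arz : A (point3 r 0 z).
  have Heps : eps < H (point3 r 0 z).
    apply: le_lt_trans Hrz; rewrite lerDr mulr_ge0 ?(ltW r0) // subr_ge0.
    exact: expm.
  apply/AE; split; [exact: ltW|by []| |exact: ltW].
  by rewrite leNgt; apply/negP => /(Hbig r); rewrite leNgt Heps.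
have [P AP Pmax] : exists2 c, c \in A & forall t, t \in A -> F t <= F c.
  apply: EVT_max_rV => //; first by exists (point3 r 0 z).
  apply: continuous_in_subspaceT => x; rewrite inE => /Apos x0.
  apply: continuous_barrier; [exact: cH | exact: coord_continuous |].
  exact: lt0r_neq0.
move: AP; rewrite inE => AP.
have PE := A2 _ AP; have r0p := Apos _ AP.
set p0 := P 0 0 in PE r0p; set p2 := P 0 2 in PE.
have B0F : B0 < F P.
  apply: (@lt_le_trans _ _ (F (point3 r 0 z))).
    by rewrite /F !mxE /= -ltrBlDr ltr_pdivlMr // mulrC ltrBrDr.
  by apply: Pmax; rewrite inE.
apply: (@barrier_not_touched R H D D2 (v0 P) (v1 P) (v2 P) p0 p2 R1 (F P)
  eta eps M) => //.
(* Contact at r = R1 is excluded, since there F <= B0 < F P. *)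
- move: AP; rewrite PE => /AE[_ + _ _]; rewrite le_eqVlt => /orP[/eqP p0R|//].
  move: B0F; rewrite ltNge => /negP; case; rewrite /F -/p0 p0R /B0 lerD2r.
  rewrite ler_pM2r ?invr_gt0 //; have := HC P; lra.
(* Where H <= eps the barrier dominates because it is at least [eps]; elsewhere the point lies in
   [A], and the maximality of [F P] gives the inequality. *)
- move=> s c s0 sR; have [Hs|Hs] := leP (H (point3 s 0 c)) eps.
    apply: (le_trans Hs); rewrite lerDr mulr_ge0 ?(ltW s0) // subr_ge0.
    by rewrite (le_trans (expm _ s0 sR)) // ltW.
  have : F (point3 s 0 c) <= F P.
    apply: Pmax; rewrite inE; apply/AE; split; [exact: ltW|by []| |exact: ltW].
    by rewrite leNgt; apply/negP => /(Hbig s); rewrite leNgt Hs.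
  by rewrite {1}/F !mxE /= -lerBrDr ler_pdivrMr // mulrC lerBlDr.
- rewrite -PE /F -/p0; field; exact: lt0r_neq0.
- by rewrite -PE; have := eqn p0 p2 r0p; rewrite /= -PE.
Qed.

(** A single choice of parameters replaces the limits: if [h > 0] is the value at (r, z), then [R1],
    [eta] and [eps] make each of the three positive terms of the bound at most h / 4, so h <= 3 h /
    4. *)
Lemma swirl_le0 (R : realType) (H v0 v1 v2 : 'rV[R]_3 -> R)
    (D D2 : 'I_3 -> 'rV[R]_3 -> R) (C M : R) :
    (forall i x, is_derive x (delta_mx 0 i) H (D i x)) ->
    (forall i x, is_derive x (delta_mx 0 i) (D i) (D2 i x)) ->
    continuous H ->
    (forall a b z, 0 < a ^+ 2 + b ^+ 2 -> H (point3 a b z) =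
      H (point3 (Num.sqrt (a ^+ 2 + b ^+ 2)) 0 z)
        * (a * (Num.sqrt (a ^+ 2 + b ^+ 2))^-1)) ->
    (forall z, H (point3 0 0 z) = 0) ->
    (forall e, 0 < e -> exists N, forall x, N < `|x| -> H x <= e) ->
    (forall x, H x <= C) -> 0 < C -> 0 < M -> (forall x, `|v0 x| <= M) ->
    (forall r z, 0 < r -> let P := point3 r 0 z in
      v0 P * D 0 P + v1 P * D 1 P + v2 P * D 2 P - H P * (v0 P / r) =
      D2 0 P + D2 1 P + D2 2 P) ->
  forall r z, 0 < r -> H (point3 r 0 z) <= 0.
Proof.
move=> dH dD cH Hsym axis decay HC C0 M0 v0M eqn r z r0.
have bound := swirl_barrier_bound dH dD cH Hsym axis decay HC C0 M0 v0M eqn.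
rewrite leNgt; apply/negP; set h := H _ => h0.
pose R1 := r + 4 * r * C / h.
have R1r : r <= R1.
  by rewrite lerDl divr_ge0 ?mulr_ge0 ?(ltW r0) ?(ltW C0) ?(ltW h0).
have R10 : 0 < R1 by exact: lt_le_trans R1r.
have E0 : 0 < expR (M ^+ 2 * R1 ^+ 2) by exact: expR_gt0.
pose eta := h / (4 * r * expR (M ^+ 2 * R1 ^+ 2)).
have eta0 : 0 < eta by rewrite divr_gt0 ?mulr_gt0.
pose eps := Num.min (h / 4) (eta / M).
have eps0 : 0 < eps by rewrite lt_min; apply/andP; split; exact: divr_gt0.
have epsM : eps * M <= eta by rewrite -ler_pdivlMr // ge_min lexx orbT.
have epsh : eps <= h / 4 by rewrite ge_min lexx.
have := bound _ _ _ R10 eta0 eps0 epsM r z r0 R1r; rewrite -/h.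
rewrite mulrBr mulrDr.
have -> : r * (eta * expR (M ^+ 2 * R1 ^+ 2)) = h / 4.
  by rewrite /eta; field; rewrite !lt0r_neq0.
have : r * (C / R1) <= h / 4.
  rewrite mulrA ler_pdivrMr // /R1 mulrDr.
  have -> : h / 4 * (4 * r * C / h) = r * C by field; exact: lt0r_neq0.
  by rewrite lerDr; apply: mulr_ge0; [apply: divr_ge0 => // | ]; exact: ltW.
have : 0 <= r * (eta * expR (M ^+ 2 * r ^+ 2)).
  apply: mulr_ge0; first exact: ltW.
  by apply: mulr_ge0; [exact: ltW | exact: expR_ge0].
lra.
Qed.

Lemma swirl_eq0 (R : realType) (H v0 v1 v2 : 'rV[R]_3 -> R)
    (D D2 : 'I_3 -> 'rV[R]_3 -> R) (C M : R) :
    (forall i x, is_derive x (delta_mx 0 i) H (D i x)) ->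
    (forall i x, is_derive x (delta_mx 0 i) (D i) (D2 i x)) ->
    continuous H ->
    (forall a b z, 0 < a ^+ 2 + b ^+ 2 -> H (point3 a b z) =
      H (point3 (Num.sqrt (a ^+ 2 + b ^+ 2)) 0 z)
        * (a * (Num.sqrt (a ^+ 2 + b ^+ 2))^-1)) ->
    (forall z, H (point3 0 0 z) = 0) ->
    (forall e, 0 < e -> exists N, forall x, N < `|x| -> `|H x| <= e) ->
    (forall x, `|H x| <= C) -> 0 < C -> 0 < M -> (forall x, `|v0 x| <= M) ->
    (forall r z, 0 < r -> let P := point3 r 0 z in
      v0 P * D 0 P + v1 P * D 1 P + v2 P * D 2 P - H P * (v0 P / r) =
      D2 0 P + D2 1 P + D2 2 P) ->
  forall r z, 0 < r -> H (point3 r 0 z) = 0.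
Proof.
move=> dH dD cH Hsym axis decay HC C0 M0 v0M eqn r z r0.
apply/eqP; rewrite eq_le; apply/andP; split.
  apply: (swirl_le0 dH dD cH Hsym axis _ _ C0 M0 v0M eqn) => //.
    move=> e /decay[N HN]; exists N => x /HN; exact: le_trans (ler_norm _).
  by move=> x; exact: le_trans (ler_norm _) (HC x).
(* The equation and the symmetry are linear in [H], so both hold for [-H] with the same drift. *)
rewrite -oppr_le0.
apply: (@swirl_le0 R (fun x => - H x) v0 v1 v2 (fun i x => - D i x)
  (fun i x => - D2 i x) C M) => //.
- by move=> x; apply: (@continuousN _ _ _ H); exact: cH.
- by move=> a b c abp; rewrite Hsym // mulNr.
- by move=> c; rewrite axis oppr0.
- move=> e /decay[N HN]; exists N => x /HN; apply: le_trans.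
  by rewrite -normrN ler_norm.
- by move=> x; apply: le_trans (HC x); rewrite -normrN ler_norm.
- move=> s c s0 P; rewrite !mulrN mulNr -!opprD -(eqn s c s0) /P; ring.
Qed.

(** * Limits at the axis, odd parts and polar angles *)

Lemma continuous_eq0_right (R : realType) (V : normedModType R) (f : R -> V) :
  {for 0, continuous f} -> (forall t, 0 < t -> f t = 0) -> f 0 = 0.
Proof.
move=> cf f0.
have h1 : f @ 0^'+ --> f 0 by apply: cvg_at_right_filter.
have h2 : f @ 0^'+ --> (0 : V).
  apply: (@cvg_trans _ ((fun=> 0 : V) @ (0 : R)^'+)); last exact: cvg_cst.
  apply: near_eq_cvg; near=> t; rewrite f0 //.
exact: (cvg_unique _ h1 h2).
Unshelve. all: by end_near. Qed.

(** The difference quotient of k(s) - k(-s) at 0 is 2 m(h), while its derivative there is 2 d. The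
    even part of [k] drops out, so only the odd part has to be known explicitly. *)
Lemma is_derive_odd_part (R : realType) (k m : R -> R) (d : R) :
  is_derive (0 : R) 1 k d -> {for 0, continuous m} ->
  (forall s, k s - k (- s) = 2 * s * m s) -> d = m 0.
Proof.
move=> dk cm km.
have d1 : is_derive (0 : R) 1 (fun s => k s - k (- s)) (d - d * -1).
  apply: (@is_deriveB _ _ _ k (fun s => k (- s))).
  apply: (@is_derive1_comp _ k -%R); first by rewrite oppr0.
have d2 : is_derive (0 : R) 1 (fun s => k s - k (- s)) (2 * m 0).
  have cv : h^-1 *: (((fun s => k s - k (- s)) (h *: 1 + 0)) - (k 0 - k (- 0)))
      @[h --> (0 : R)^'] --> 2 * m 0.
    apply: (@cvg_trans _ ((fun h => 2 * m h) @ (0 : R)^')).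
      apply: near_eq_cvg; near=> h.
      have h0 : h != 0 by near: h; exact: nbhs_dnbhs_neq.
      by rewrite km /GRing.scale /= oppr0 subrr subr0 mulr1 addr0; field.
    by apply: cvgMl_tmp; apply: cvg_within_filter; exact: cm.
  by apply: DeriveDef; [apply/cvg_ex; exists (2 * m 0) | exact/cvg_lim].
have : d - d * -1 = 2 * m 0.
  by rewrite -(@derive_val _ _ _ _ _ _ _ d1) (@derive_val _ _ _ _ _ _ _ d2).
lra.
Unshelve. all: by end_near. Qed.

(** The angle is acos (a / rho), with the sign of [b]. *)
Lemma polar_decomposition (R : realType) (a b : R) : 0 < a ^+ 2 + b ^+ 2 ->
  exists theta, a = Num.sqrt (a ^+ 2 + b ^+ 2) * cos theta /\
    b = Num.sqrt (a ^+ 2 + b ^+ 2) * sin theta.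
Proof.
move=> ab0; set rho := Num.sqrt _.
have rho0 : 0 < rho by rewrite sqrtr_gt0.
have rho2 : rho ^+ 2 = a ^+ 2 + b ^+ 2 by rewrite sqr_sqrtr // ltW.
have ar : -1 <= a / rho <= 1.
  rewrite -ler_norml normrM normfV (gtr0_norm rho0) ler_pdivrMr // mul1r.
  rewrite -ler_sqr ?nnegrE ?(ltW rho0) // real_normK ?num_real // rho2.
  by rewrite lerDl sqr_ge0.
have cosE : cos (acos (a / rho)) = a / rho by rewrite acosK.
have sinE : sin (acos (a / rho)) = `|b| / rho.
  have -> : `|b| / rho = Num.sqrt ((b / rho) ^+ 2).
    by rewrite sqrtr_sqr normrM normfV (gtr0_norm rho0).
  rewrite sin_acos //; congr Num.sqrt; rewrite !exprMn !exprVn.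
  have -> : b ^+ 2 = rho ^+ 2 - a ^+ 2 by rewrite rho2; ring.
  by field; exact: lt0r_neq0.
have [b0|b0] := leP 0 b.
  exists (acos (a / rho)); rewrite cosE sinE ger0_norm //.
  by split; field; exact: lt0r_neq0.
exists (- acos (a / rho)); rewrite cosN sinN cosE sinE ltr0_norm //.
by split; field; exact: lt0r_neq0.
Qed.

(** * Components and decay of vector fields *)

Lemma is_derive_coord (R : realType) (V : normedModType R) (n : nat)
    (f : V -> 'rV[R]_n) (x v : V) (j : 'I_n) :
  differentiable f x -> is_derive x v (fun y => f y 0 j) ('D_v f x 0 j).
Proof.
move=> df; have fv : derivable f x v := diff_derivable df.
have fj : derivable (fun y => f y 0 j) x v by move/derivable_mxP: fv; exact.
by rewrite derive_mx // mxE; exact/derivableP.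
Qed.

Lemma at_infinity_small (R : realType) (f : 'rV[R]_3 -> 'rV[R]_3) :
  f x @[x --> at_infinity R] --> (0 : 'rV[R]_3) ->
  forall e, 0 < e -> exists N, forall x, N < `|x| -> `|f x| <= e.
Proof.
move=> f0 e e0; have [N _ HN] := f0 _ (nbhsx_ballx (0 : 'rV[R]_3) e e0).
exists N => x /HN; rewrite /= -ball_normE /= sub0r normrN; exact: ltW.
Qed.

(** Decay bounds [f] by 1 outside a box, and compactness bounds it inside. The box uses [|N|] so
    that it contains 0 even when [N] is negative. *)
Lemma bounded_of_decay (R : realType) (f : 'rV[R]_3 -> 'rV[R]_3) :
  continuous f -> f x @[x --> at_infinity R] --> (0 : 'rV[R]_3) ->
  exists2 M, 0 < M & forall x, `|f x| <= M.
Proof.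
move=> cf /at_infinity_small /(_ 1 ltr01)[N HN].
pose A : set 'rV[R]_3 := [set x | forall i, `[- `|N|, `|N|]%classic (x ord0 i)].
have cA : compact A.
  apply: (@rV_compact R 3 (fun=> `[- `|N|, `|N|]%classic)) => _.
  exact: segment_compact.
have A0 : A !=set0.
  by exists 0 => i; rewrite mxE /= in_itv /= oppr_le0 normr_ge0.
have [|c _ cmax] := @EVT_max_rV R 3 (fun x => `|f x|) A A0 cA.
  apply: continuous_subspaceT => x.
  apply: (@continuous_comp _ _ _ f (fun y : 'rV[R]_3 => `|y|)).
    exact: cf.
  exact: norm_continuous.
exists (1 + `|f c|); first by rewrite ltr_pwDl.
move=> x; have [xN|xN] := ltP `|N| `|x|.
  have /HN fx : N < `|x| by exact: le_lt_trans (ler_norm N) xN.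
  by rewrite (le_trans fx) // lerDl.
apply: (@le_trans _ _ `|f c|); last by rewrite lerDr.
apply: cmax; rewrite inE => i; rewrite /= in_itv /= -ler_norml.
exact: le_trans (ler_norm_coord x i) xN.
Qed.

(** * The swirl equation on the half-plane and the vanishing of h *)

(** This is the x_2 component of the induction equation at a point where [h] points along x_2, so
    that (h . nabla) u reduces to h_2 times the x_2 derivative of u. The value [b] will be u_r /
    r. *)
Lemma swirl_induction_equation (R : realType) (u h : 'rV[R]_3 -> 'rV[R]_3)
    (x : 'rV[R]_3) (b : R) :
  advection u h x - advection h u x = laplacian h x ->
  h x 0 0 = 0 -> h x 0 2 = 0 -> partial 1 u x 0 1 = b ->
  u x 0 0 * partial 0 h x 0 1 + u x 0 1 * partial 1 h x 0 1 +
    u x 0 2 * partial 2 h x 0 1 - h x 0 1 * b =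
  partial 0 (partial 0 h) x 0 1 + partial 1 (partial 1 h) x 0 1 +
    partial 2 (partial 2 h) x 0 1.
Proof.
rewrite /advection /laplacian !sum_ord3.
move: (partial 0 (partial 0 h) x) (partial 1 (partial 1 h) x)
  (partial 2 (partial 2 h) x) (partial 0 h x) (partial 1 h x) (partial 2 h x)
  (partial 0 u x) (partial 1 u x) (partial 2 u x) (u x) (h x).
move=> A0 A1 A2 B0 B1 B2 C0 C1 C2 U K /(congr1 (fun v : 'rV[R]_3 => v 0 1)).
by rewrite !mxE => eqn K0 K2 <-; rewrite -eqn K0 K2 !mul0r add0r addr0.
Qed.

Theorem theorem3p3 (R : realType)
    (u h : 'rV[R]_3 -> 'rV[R]_3) (p : 'rV[R]_3 -> R)
    (u_r u_theta u_z h_theta : R -> R -> R)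
    (u_smooth : smooth u) (h_smooth : smooth h)
    (p_diff : forall x : 'rV[R]_3, differentiable p x)
    (mhd : steady_MHD u h p)
    (u_decay : u x @[x --> at_infinity R] --> (0 : 'rV[R]_3))
    (h_decay : h x @[x --> at_infinity R] --> (0 : 'rV[R]_3))
    (u_form : axisymmetric_form u u_r u_theta u_z)
    (h_form : swirl_form h h_theta) :
  forall x : 'rV[R]_3, h x = 0.
Proof.
have cu : continuous u.
  by move=> x; exact: differentiable_continuous (u_smooth [::] x).
have ch : continuous h.
  by move=> x; exact: differentiable_continuous (h_smooth [::] x).
have [M M0 uM] := bounded_of_decay cu u_decay.
have [C C0 hC] := bounded_of_decay ch h_decay.
have cj (f : 'rV[R]_3 -> 'rV[R]_3) j : continuous f ->
    continuous (fun x => f x 0 j).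
  move=> cf x; apply: (@continuous_comp _ _ _ f (fun y : 'rV[R]_3 => y 0 j)).
    exact: cf.
  exact: coord_continuous.
(* On the half-plane theta = 0 the vector e_theta is the x_2 direction, so [H] equals [h_theta]
   there; unlike [h_theta], it is a smooth function on the whole space. *)
pose H x := h x 0 1.
have h_polar rho theta z : 0 < rho ->
    h (point3 (rho * cos theta) (rho * sin theta) z) =
    H (point3 rho 0 z) *: e_theta theta.
  move=> rho0; rewrite /H; have h1 := h_form rho 0 z rho0.
  have h2 := h_form rho theta z rho0.
  move: h1; rewrite /cylindrical cos0 sin0 mulr1 mulr0 => h1.
  rewrite /point3 -/(cylindrical rho theta z) h2 h1 !mxE /= cos0 mulr1 //.
(* The x_2 component of e_theta is cos theta = a / rho. *)
have Hsym a b z : 0 < a ^+ 2 + b ^+ 2 -> H (point3 a b z) =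
    H (point3 (Num.sqrt (a ^+ 2 + b ^+ 2)) 0 z)
      * (a * (Num.sqrt (a ^+ 2 + b ^+ 2))^-1).
  move=> ab0; have [theta []] := polar_decomposition ab0.
  have rho0 : 0 < Num.sqrt (a ^+ 2 + b ^+ 2) by rewrite sqrtr_gt0.
  set rho := Num.sqrt _ in rho0 * => aE bE.
  rewrite aE bE {1}/H h_polar // !mxE /=.
  by congr (_ * _); field; exact: lt0r_neq0.
have c0 (f : 'rV[R]_3 -> R) b z : continuous f ->
    continuous (fun t => f (point3 t b z)).
  move=> cf t.
  have e s : point3 s b z = s *: delta_mx 0 (0 : 'I_3) + point3 0 b z.
    by have [-> _ _] := point3_line 0 b z s; rewrite add0r.
  under eq_fun do rewrite e.
  apply: (@continuous_comp _ _ _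
    (fun s : R => s *: delta_mx 0 (0 : 'I_3) + point3 0 b z) f).
    exact: continuous_line.
  exact: cf.
(* By [Hsym], [H] is odd in x_1 on the plane x_2 = 0; continuity gives 2 H = 0 on the axis. *)
have axis z : H (point3 0 0 z) = 0.
  pose T t := H (point3 t 0 z).
  have cT : continuous T by exact/c0/cj.
  have : T 0 + T (- 0) = 0.
    apply: (@continuous_eq0_right R R^o (fun t => T t + T (- t))).
      apply: (@continuousD _ _ _ T (fun t => T (- t))); first exact: cT.
      apply: (@continuous_comp _ _ _ -%R T); last exact: cT.
      exact: opp_continuous.
    move=> t t0; have tt0 : 0 < (- t) ^+ 2 + 0 ^+ 2.
      by rewrite expr0n addr0 sqrrN exprn_gt0.
    rewrite /T (Hsym _ _ _ tt0) expr0n addr0 sqrrN sqrtr_sqr gtr0_norm //.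
    by rewrite mulNr divff ?lt0r_neq0 // mulrN1 subrr.
  by rewrite oppr0 /T => ?; lra.
have dcoord (f : 'rV[R]_3 -> 'rV[R]_3) (df : smooth f) s i x :
    is_derive x (delta_mx 0 i) (fun y => foldr (@partial R _) f s y 0 1)
      (foldr (@partial R _) f (i :: s) x 0 1).
  exact: is_derive_coord (df s x).
(* Along x_2 = s, the x_2 component of u is s u_r / rho + r u_theta / rho. The second term is even
   in s, so the derivative at 0 is the value of m = u_r / rho at s = 0. Both u_r and u_theta are
   read off from [u] at theta = 0. *)
have du1 r z : 0 < r ->
    partial 1 u (point3 r 0 z) 0 1 = u (point3 r 0 z) 0 0 / r.
  move=> r0; pose rho s := Num.sqrt (r ^+ 2 + s ^+ 2).
  pose m s := u (point3 (rho s) 0 z) 0 0 * (rho s)^-1.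
  have rhor : rho 0 = r by rewrite /rho expr0n addr0 sqrtr_sqr gtr0_norm.
  have u1E s : u (point3 r s z) 0 1 =
      s * m s + r * (u (point3 (rho s) 0 z) 0 1 * (rho s)^-1).
    have q0 : 0 < r ^+ 2 + s ^+ 2 by rewrite ltr_wpDr ?sqr_ge0 ?exprn_gt0.
    have [theta []] := polar_decomposition q0; rewrite /m -/(rho s).
    have rs0 : 0 < rho s by rewrite sqrtr_gt0.
    move=> rE sE; have h1 := u_form (rho s) 0 z rs0.
    have h2 := u_form (rho s) theta z rs0.
    move: h1; rewrite /cylindrical cos0 sin0 mulr1 mulr0 -/(point3 _ _ _) => ->.
    move: h2; rewrite /cylindrical -rE -sE -/(point3 _ _ _) => ->.
    rewrite !mxE /= cos0 sin0 oppr0 !mulr0 !mulr1 !addr0 add0r.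
    have -> : sin theta = s / rho s by rewrite {1}sE mulrC mulKf ?lt0r_neq0.
    have -> : cos theta = r / rho s by rewrite {1}rE mulrC mulKf ?lt0r_neq0.
    ring.
  have crho : {for 0, continuous rho}.
    apply: (@continuous_comp _ _ _ (fun s : R => r ^+ 2 + s ^+ 2) Num.sqrt).
      apply: (@continuousD _ _ _ (fun=> r ^+ 2) (fun s : R => s ^+ 2)).
        exact: cst_continuous.
      exact: exprn_continuous.
    exact: sqrt_continuous.
  have cm : {for 0, continuous m}.
    apply: (@continuousM _ _ (fun s => u (point3 (rho s) 0 z) 0 0)
      (fun s => (rho s)^-1)).
      apply: (@continuous_comp _ _ _ rho (fun t => u (point3 t 0 z) 0 0)) => //.
      exact: (c0 (fun y => u y 0 0) _ _ (cj u 0 cu)).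
    by apply: continuousV => //; rewrite rhor lt0r_neq0.
  rewrite -rhor -/(m 0) rhor.
  apply: (@is_derive_odd_part R (fun s => u (point3 r s z) 0 1) m) => //.
    have lE s : s *: delta_mx 0 (1 : 'I_3) + point3 r 0 z = point3 r s z.
      by have [_ -> _] := point3_line r 0 z s; rewrite add0r.
    have := is_derive_line
      (dcoord u u_smooth [::] 1 (0 *: delta_mx 0 1 + point3 r 0 z)).
    by under eq_fun do rewrite lE; rewrite lE.
  move=> s; rewrite !u1E /m /rho sqrrN; ring.
have Heq0 r z : 0 < r -> H (point3 r 0 z) = 0.
  apply: (@swirl_eq0 R H
    (fun x => u x 0 0) (fun x => u x 0 1) (fun x => u x 0 2)
    (fun i x => partial i h x 0 1) (fun i x => partial i (partial i h) x 0 1)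
    C M) => //.
  - by move=> i x; exact: (dcoord h h_smooth [::]).
  - by move=> i x; exact: (dcoord h h_smooth [:: i]).
  - exact: cj.
  - move=> e /(at_infinity_small h_decay)[N HN]; exists N => y /HN.
    exact: le_trans (ler_norm_coord _ _).
  - by move=> y; exact: le_trans (ler_norm_coord _ _) (hC y).
  - by move=> y; exact: le_trans (ler_norm_coord _ _) (uM y).
  move=> s c s0 P; have [_ _ eqn _] := mhd P.
  have hP : h P = H P *: e_theta 0.
    by rewrite -h_polar // cos0 sin0 mulr1 mulr0.
  have [hP0 hP2] : h P 0 0 = 0 /\ h P 0 2 = 0.
    by rewrite hP; move: (H P) => k; rewrite !mxE /= sin0 oppr0 !mulr0.
  exact: swirl_induction_equation eqn hP0 hP2 (du1 s c s0).
have h_off a b z : 0 < a ^+ 2 + b ^+ 2 -> h (point3 a b z) = 0.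
  move=> ab0; have [theta []] := polar_decomposition ab0.
  have rho0 : 0 < Num.sqrt (a ^+ 2 + b ^+ 2) by rewrite sqrtr_gt0.
  set rho := Num.sqrt _ in rho0 * => aE bE; rewrite aE bE h_polar // Heq0 //.
  by rewrite scale0r.
move=> x; rewrite [x]point3_eta; move: (x 0 0) (x 0 1) (x 0 2) => a b z.
have [ab0|] := ltP 0 (a ^+ 2 + b ^+ 2); first exact: h_off.
move=> ab; have [-> ->] : a = 0 /\ b = 0.
  have a2 := sqr_ge0 a; have b2 := sqr_ge0 b.
  by split; apply/eqP; rewrite -sqrf_eq0; apply/eqP; lra.
(* A point of the axis is the limit of points (t, 0, z) with t > 0, where [h] is already known to
   vanish. *)
apply/rowP => j; rewrite mxE.
apply: (@continuous_eq0_right R R^o (fun t => h (point3 t 0 z) 0 j)).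
  exact: (c0 (fun y => h y 0 j) _ _ (cj h j ch)).
by move=> t t0; rewrite h_off ?mxE // expr0n addr0 exprn_gt0.
Qed.
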